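(* Let $\phi$ be a Maltsev operation over a finite domain $D$. Then $\mathrm{CSP}(\mathrm{Inv}(\{\phi\}))$ has chain length $O(|D||V|)$, where $V$ denotes the set of variables of an instance.
   Context: A Maltsev operation over $D\supseteq\{0,1\}$ is a ternary operation $\phi$ with $\phi(x,x,y)=y$ and $\phi(x,y,y)=x$ for all $x,y\in D$. $\mathrm{Inv}(\{\phi\})$ is the set of all finitary relations over $D$ preserved by $\phi$ (closed under componentwise application of $\phi$). An instance of $\mathrm{CSP}(\Delta)$ is a pair $(V,C)$ of a finite nonempty variable set $V$ and a finite set $C$ of constraint applications $R(v_1,\dots,v_k)$ with $R\in\Delta$, $v_i\in V$. For an $n$-ary relation $R$, $\mathrm{Sig}(R)$ is the set of $(i,a,b)\in\{1,\dots,n\}\times D^2$ such that some $t,t'\in R$ agree on coordinates $1,\dots,i-1$ and have $t[i]=a$, $t'[i]=b$. A compact representation of $R$ is a subset $R'\subseteq R$ with $\mathrm{Sig}(R')=\mathrm{Sig}(R)$ and $|R'|\le 2|\mathrm{Sig}(R)|$. $\langle S\rangle_\phi$ is the smallest superset of $S$ preserved by $\phi$; if $S$ is a representation of $R\in\mathrm{Inv}(\{\phi\})$ then $\langle S\rangle_\phi=R$. Chain length: for an instance $I=(V,\{C_1,\dots,C_m\})$ of $\mathrm{CSP}(\mathrm{Inv}(\{\phi\}))$ (constraints in any order), let $S_i$ be a compact representation of the solution set (as a $|V|$-ary relation over $D$) of $(V,\{C_1,\dots,C_i\})$, $0\le i\le m$. Chain length $O(|D||V|)$ means that $|\{\langle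 S_i\rangle_\phi\mid 0\le i\le m\}|$, i.e. the number of distinct solution sets in the chain, is $O(|D||V|)$ over all instances $I$. *)

(* Defs.v *)
From mathcomp Require Import all_boot finmap.

Set Implicit Arguments.
Unset Strict Implicit.
Unset Printing Implicit Defensive.

Definition maltsev (D : Type) (phi : D -> D -> D -> D) : Prop :=
  forall x y : D, phi x x y = y /\ phi x y y = x.

Definition app_tuple (D : Type) (phi : D -> D -> D -> D) (k : nat)
    (t1 t2 t3 : k.-tuple D) : k.-tuple D :=
  [tuple phi (tnth t1 i) (tnth t2 i) (tnth t3 i) | i < k].

Definition preserved (D : finType) (phi : D -> D -> D -> D) (k : nat)
    (R : {set k.-tuple D}) : bool :=
  [forall t1 in R, forall t2 in R, forall t3 in R, app_tuple phi t1 t2 t3 \in R].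

(* A set of finitary relations over D, as a predicate for each arity. *)
Definition language (D : finType) := forall k : nat, {set k.-tuple D} -> Prop.

Definition Inv (D : finType) (phi : D -> D -> D -> D) : language D :=
  fun k R => preserved phi R.

(* The application R(v_1, ..., v_k) is the triple of k, R and (v_1, ..., v_k). *)
Definition constraint (D V : finType) :=
  {k : nat & ({set k.-tuple D} * k.-tuple V)%type}.

Definition crel (D V : finType) (c : constraint D V) : {set (tag c).-tuple D} :=
  (tagged c).1.
Definition cscope (D V : finType) (c : constraint D V) : (tag c).-tuple V :=
  (tagged c).2.

Record instance (D : finType) := Instance {
  var : finType;
  constraints : {fset constraint D var}
}.

Definition instance_of (D : finType) (Delta : language D) (I : instance D) :
    Prop :=
  0 < #|var I| /\ forall c, c \in constraints I -> Delta _ (crel c).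

(* An assignment V -> D is a #|V|-tuple: the value of v is the coordinate of
   index enum_rank v. *)
Definition satisfies (D V : finType) (t : #|V|.-tuple D) (c : constraint D V) :
    bool :=
  [tuple of [seq tnth t (enum_rank v) | v <- cscope c]] \in crel c.

Definition solutions (D V : finType) (cs : seq (constraint D V)) :
    {set #|V|.-tuple D} :=
  [set t | all (satisfies t) cs].

Definition Sig (D : finType) (n : nat) (R : {set n.-tuple D}) :
    {set 'I_n * D * D} :=
  [set x : 'I_n * D * D | let: (i, a, b) := x in
     [exists t in R, exists t' in R,
        [&& [forall j : 'I_n, (j < i) ==> (tnth t j == tnth t' j)],
            tnth t i == a & tnth t' i == b]]].

Definition compact_representation (D : finType) (n : nat)
    (R' R : {set n.-tuple D}) : Prop :=
  [/\ R' \subset R, Sig R' = Sig R & #|R'| <= 2 * #|Sig R|].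

(* The smallest preserved superset of S: the family intersected contains the
   full relation, and preserved relations are closed under intersection. *)
Definition generated (D : finType) (phi : D -> D -> D -> D) (n : nat)
    (S : {set n.-tuple D}) : {set n.-tuple D} :=
  \bigcap_(R : {set n.-tuple D} | (S \subset R) && preserved phi R) R.

(* s lists the constraints of I in an arbitrary order, without repetition. *)
Definition chain_length_le (D : finType) (phi : D -> D -> D -> D)
    (I : instance D) (N : nat) : Prop :=
  forall s : seq (constraint D (var I)), perm_eq s (constraints I) ->
  forall S : 'I_(size s).+1 -> {set #|var I|.-tuple D},
  (forall i, compact_representation (S i) (solutions (take i s))) ->
  #|[set generated phi (S i) | i : 'I_(size s).+1]| <= N.

(* Main.v *)
(** For an invariant relation R and a coordinate i, the pairs (a, b) with
    (i, a, b) in Sig(R) form an equivalence relation on the projection of R to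
    coordinate i. Fix a linear order on D and record, for each i, the elements
    of this projection and those that are not minimal in their class. Both sets
    shrink with R, and an invariant relation is determined by them inside any
    larger invariant relation. So a strictly decreasing chain of invariant
    relations has at most 2|D|n + 1 members. *)
Require Import Defs.
From mathcomp Require Import all_boot finmap.

Set Implicit Arguments.
Unset Strict Implicit.
Unset Printing Implicit Defensive.

Section Signature.
Variables (D : finType) (n : nat).
Implicit Types (R G : {set n.-tuple D}) (i : 'I_n) (a b c : D).

Lemma SigP R i a b :
  reflect (exists t t', [/\ t \in R, t' \in R,
             forall j : 'I_n, j < i -> tnth t j = tnth t' j,
             tnth t i = a & tnth t' i = b])
          ((i, a, b) \in Sig R).
Proof.
rewrite inE; apply: (iffP exists_inP).
  case=> t tR /exists_inP[t' t'R /and3P[/forallP agr /eqP ta /eqP t'b]].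
  by exists t, t'; split=> // j ji; apply/eqP; have /implyP := agr j; apply.
case=> t [t' [tR t'R agr ta t'b]]; exists t => //; apply/exists_inP; exists t' => //.
rewrite ta t'b !eqxx !andbT; apply/forallP=> j; apply/implyP=> ji.
by rewrite (agr j ji).
Qed.

Lemma Sig_mono G R : G \subset R -> Sig G \subset Sig R.
Proof.
move=> /subsetP sGR; apply/subsetP=> -[[i a] b] /SigP[t [t' [tG t'G agr ta t'b]]].
by apply/SigP; exists t, t'; split=> //; apply: sGR.
Qed.

Lemma Sig_diag R (t : n.-tuple D) i :
  t \in R -> (i, tnth t i, tnth t i) \in Sig R.
Proof. by move=> tR; apply/SigP; exists t, t. Qed.

Lemma Sig_sym R i a b : (i, a, b) \in Sig R -> (i, b, a) \in Sig R.
Proof.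
case/SigP=> t [t' [tR t'R agr ta t'b]]; apply/SigP; exists t', t.
by split=> // j /agr.
Qed.

Lemma Sig_reflr R i a b : (i, a, b) \in Sig R -> (i, b, b) \in Sig R.
Proof. by case/SigP=> t [t' [_ t'R _ _ <-]]; apply: Sig_diag. Qed.

(** Recording non-minimality rather than minimality makes the condition existential, hence monotone
    in [R]. *)
Definition nonminimal R i b : bool :=
  [exists a, (enum_rank a < enum_rank b) && ((i, a, b) \in Sig R)].

(* The tag [false] marks the elements of the i-th projection of R, the tag
   [true] those that are not minimal in their class. *)
Definition profile R : {set 'I_n * D * bool} :=
  [set x | let: (i, b, m) := x in
     if m then nonminimal R i b else (i, b, b) \in Sig R].

Lemma profile_mono G R : G \subset R -> profile G \subset profile R.
Proof.
move=> sGR; have /subsetP sS := Sig_mono sGR.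
apply/subsetP=> -[[i b] []]; rewrite ![_ \in profile _]inE; last exact: sS.
case/existsP=> a /andP[ab /sS abR]; apply/existsP; exists a.
by rewrite ab.
Qed.

Variable phi : D -> D -> D -> D.
Hypothesis phiM : maltsev phi.

Lemma preserved_app R (t1 t2 t3 : n.-tuple D) : preserved phi R ->
  t1 \in R -> t2 \in R -> t3 \in R -> app_tuple phi t1 t2 t3 \in R.
Proof.
by move=> /forall_inP pR /pR /forall_inP H /H /forall_inP H' /H'.
Qed.

(** A witnessing pair [u], [u'] can be rebased at [t] by taking [phi t u u']: before [i] it reads
    [phi x y y = x], and at [i], where [t] and [u] agree, [phi x x y = y]. *)
Lemma Sig_follow R i b (t : n.-tuple D) : preserved phi R ->
  t \in R -> (i, tnth t i, b) \in Sig R ->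
  exists t', [/\ t' \in R, forall j : 'I_n, j < i -> tnth t j = tnth t' j
               & tnth t' i = b].
Proof.
move=> pR tR /SigP[u [u' [uR u'R agr ua u'b]]].
exists (app_tuple phi t u u'); split; first exact: preserved_app.
  by move=> j ji; rewrite tnth_mktuple (agr j ji) (phiM _ _).2.
by rewrite tnth_mktuple ua u'b (phiM _ _).1.
Qed.

Lemma Sig_trans R i b a c : preserved phi R ->
  (i, a, b) \in Sig R -> (i, b, c) \in Sig R -> (i, a, c) \in Sig R.
Proof.
move=> pR /SigP[t [t' [tR t'R agr ta <-]]] /(Sig_follow pR t'R)[u [uR agr' uc]].
by apply/SigP; exists t, u; split=> // j ji; rewrite agr ?agr'.
Qed.

Lemma class_minimum R i a : preserved phi R -> (i, a, a) \in Sig R ->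
  exists2 m, (i, a, m) \in Sig R & ~~ nonminimal R i m.
Proof.
move=> pR aa.
case: (arg_minnP (fun x => enum_rank x : nat)
                 (aa : (fun x => (i, a, x) \in Sig R) a)) => m am min_m.
exists m => //; apply/existsP=> -[x /andP[xm /Sig_sym mx]].
by have := min_m x (Sig_trans pR am mx); rewrite leqNgt xm.
Qed.

(** For [(i, a, b)] in [Sig R], take minimal elements [a0], [b0] of the [G]-classes of [a] and [b].
    Equal profiles make both minimal in [R] as well, and they share an [R]-class, so they coincide
    and join [a] to [b] in [G]. *)
Lemma profile_Sig G R : preserved phi G -> preserved phi R -> G \subset R ->
  profile G = profile R -> Sig G = Sig R.
Proof.
move=> pG pR sGR eqW; apply/eqP; rewrite eqEsubset Sig_mono //=.
have /subsetP sS := Sig_mono sGR.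
have eq_dom i a : (i, a, a) \in Sig R -> (i, a, a) \in Sig G.
  by have /setP/(_ (i, a, false)) := eqW; rewrite ![(_, false) \in _]inE => ->.
have eq_min i a : nonminimal R i a = nonminimal G i a.
  by have /setP/(_ (i, a, true)) := eqW; rewrite ![(_, true) \in _]inE => ->.
apply/subsetP=> -[[i a] b] abR.
have [a0 aa0 min_a0] := class_minimum pG (eq_dom _ _ (Sig_reflr (Sig_sym abR))).
have [b0 bb0 min_b0] := class_minimum pG (eq_dom _ _ (Sig_reflr abR)).
have a0b0 : (i, a0, b0) \in Sig R.
  apply: (Sig_trans pR) (sS _ bb0).
  by apply: (Sig_trans pR) abR; apply/Sig_sym/sS.
suff eq0 : a0 = b0 by apply: (Sig_trans pG aa0); rewrite eq0; apply: Sig_sym.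
case: (ltngtP (enum_rank a0) (enum_rank b0)) => [lt|lt|/val_inj/enum_rank_inj //].
  by move: min_b0; rewrite -eq_min => /existsP[]; exists a0; rewrite lt.
by move: min_a0; rewrite -eq_min => /existsP[]; exists b0; rewrite lt Sig_sym.
Qed.

(** A tuple of [G] is steered towards [t] one coordinate at a time, each correction being licensed
    by the common signature. *)
Lemma Sig_inj G R : 0 < n -> preserved phi G -> G \subset R ->
  Sig G = Sig R -> G = R.
Proof.
move=> n_gt0 pG sGR eqS; apply/eqP; rewrite eqEsubset sGR /=.
apply/subsetP=> t tR.
suff /(_ n (leqnn n))[g gG agr] : forall k, k <= n ->
    exists2 g, g \in G & forall j : 'I_n, j < k -> tnth g j = tnth t j.
  by rewrite -(_ : g = t) //; apply: eq_from_tnth => j; apply: agr.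
elim=> [_|k IH lt_kn].
  (* Coordinate 0 is what lets the signature detect that [G] is nonempty. *)
  have := Sig_diag (Ordinal n_gt0) tR; rewrite -eqS => /SigP[g [_ [gG _ _ _ _]]].
  by exists g.
have [g gG agr] := IH (ltnW lt_kn); pose i := Ordinal lt_kn.
have : (i, tnth g i, tnth t i) \in Sig G.
  rewrite eqS; apply/SigP; exists g, t; split=> //.
  exact: (subsetP sGR).
case/(Sig_follow pG gG)=> g' [g'G agr' g'i]; exists g' => // j.
rewrite ltnS leq_eqVlt => /predU1P[jk|jk]; last by rewrite -agr' ?agr.
by rewrite (_ : j = i) //; apply: val_inj.
Qed.

(** The generated relation lies between [G] and [R], so its signature is squeezed to [Sig R]. *)
Lemma generated_Sig G R : 0 < n -> preserved phi R -> G \subset R ->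
  Sig G = Sig R -> generated phi G = R.
Proof.
move=> n_gt0 pR sGR eqS.
have sH : generated phi G \subset R by apply: bigcap_inf; rewrite sGR.
have sG : G \subset generated phi G by apply/bigcapsP=> S /andP[].
apply: Sig_inj => //.
  apply/forall_inP=> t1 /bigcapP t1G; apply/forall_inP=> t2 /bigcapP t2G.
  apply/forall_inP=> t3 /bigcapP t3G; apply/bigcapP=> S GS.
  have /andP[_ pS] := GS.
  by apply: preserved_app => //; [apply: t1G | apply: t2G | apply: t3G].
by apply/eqP; rewrite eqEsubset Sig_mono //= -eqS Sig_mono.
Qed.

Lemma chain_card (C : {set {set n.-tuple D}}) : 0 < n ->
  {in C, forall R, preserved phi R} ->
  {in C &, forall G R, (G \subset R) || (R \subset G)} ->
  #|C| <= (n * #|D| * 2).+1.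
Proof.
move=> n_gt0 pC totC; pose N := #|{: 'I_n * D * bool}|.
have cardN : N = n * #|D| * 2 by rewrite /N !card_prod card_ord card_bool.
(* Profile sizes range over 0, ..., [N], so [inord] never falls back to its default. On a chain,
   equal sizes force equal profiles. *)
pose f R : 'I_N.+1 := inord #|profile R|.
have f_val R : f R = #|profile R| :> nat by rewrite inordK // ltnS max_card.
have inj_sub G R : G \in C -> R \in C -> G \subset R -> f G = f R -> G = R.
  move=> GC RC sGR /(congr1 val); rewrite /= !f_val => eq_card.
  apply: Sig_inj => //; first exact: pC.
  apply: profile_Sig => //; try exact: pC.
  by apply/eqP; rewrite eqEcard profile_mono //= eq_card.
have injf : {in C &, injective f}.
  move=> G R GC RC eqf; have /orP[sGR|sRG] := totC G R GC RC.
    exact: inj_sub.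
  by apply/esym/inj_sub.
by rewrite -cardN -(card_in_imset injf) -[leqRHS]card_ord max_card.
Qed.

End Signature.

Lemma solutions_preserved (D V : finType) (phi : D -> D -> D -> D)
    (cs : seq (constraint D V)) :
  (forall c, c \in cs -> preserved phi (crel c)) -> preserved phi (solutions cs).
Proof.
move=> pcs; apply/forall_inP=> t1; rewrite inE => /allP s1.
apply/forall_inP=> t2; rewrite inE => /allP s2.
apply/forall_inP=> t3; rewrite inE => /allP s3.
rewrite inE; apply/allP=> c c_cs.
rewrite /satisfies.
have := preserved_app (pcs c c_cs) (s1 c c_cs) (s2 c c_cs) (s3 c c_cs).
(* Applying [phi] coordinatewise commutes with restriction to the scope. *)
set u := app_tuple _ _ _ _; set v := [tuple of _]; suff -> : u = v by [].
by apply: eq_from_tnth => i; rewrite tnth_mktuple !tnth_map tnth_ord_tuple.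
Qed.

Lemma solutions_take_anti (D V : finType) (cs : seq (constraint D V)) i j :
  i <= j -> solutions (take j cs) \subset solutions (take i cs).
Proof.
move=> ij; apply/subsetP=> t; rewrite !inE -(subnKC ij) takeD all_cat.
by case/andP.
Qed.

Theorem theorem17 :
  exists c : nat,
    forall (D : finType) (zero one : D) (phi : D -> D -> D -> D),
      zero != one ->
      maltsev phi ->
      forall I : instance D,
        instance_of (Inv phi) I ->
        chain_length_le phi I (c * (#|D| * #|var I|)).
Proof.
exists 3 => D zero one phi _ phiM I [V_gt0 invI] s perm_s S cS.
have pR i : preserved phi (solutions (take i s)).
  apply: solutions_preserved => c /mem_take.
  by rewrite (perm_mem perm_s); apply: invI.
have genS i : generated phi (S i) = solutions (take i s).
  by case: (cS i) => sub eqS _; exact: (generated_Sig phiM V_gt0 (pR i)).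
have DV_gt0 : 0 < #|D| * #|var I|.
  by rewrite muln_gt0 V_gt0 andbT; apply/card_gt0P; exists zero.
(* The extra 1 is absorbed by a third copy of the positive product, whence the constant 3. *)
have bound : (#|var I| * #|D| * 2).+1 <= 3 * (#|D| * #|var I|).
  by rewrite (mulnC #|var I|) (mulnC _ 2) mulSn -add1n leq_add2r.
apply: leq_trans bound; apply: (chain_card phiM) => //.
  by move=> _ /imsetP[i _ ->]; rewrite genS.
move=> _ _ /imsetP[i _ ->] /imsetP[j _ ->]; rewrite !genS.
by case/orP: (leq_total i j) => ij; rewrite (solutions_take_anti _ ij) ?orbT.
Qed.
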